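(* Let $X$ be a Banach space, let $T \in \mathscr{L}(X)$ and let $(\gamma_n)_{n \geq 0} \subset \mathbb{C}^*$ be given, and let $\mathscr{F}$ be a hypercyclicity set. If there exist a dense subset $\mathcal{D}$ of $X$ and a map $S \colon \mathcal{D} \to \mathcal{D}$ such that, for each $y \in \mathcal{D}$, (i) $\sum_{n=0}^{\infty} \|\gamma_n\, S^n y\| < \infty$, (ii) $\displaystyle \sup_{r \geq m} \Bigl(\sum_{n=0}^{r-m} \Bigl\|\frac{\gamma_n}{\gamma_r}\, T^{r-n}y\Bigr\|\Bigr) + \sup_{r \geq 1}\Bigl(\sum_{n = m + r}^\infty \Bigl\| \frac{\gamma_n}{\gamma_r}\, S^{n-r}y\Bigr\|\Bigr) \longrightarrow 0$ as $m \to \infty$, (iii) $T S y = y$, then $T$ is $\mathscr{F}_{\Gamma^{-1}}$-hypercyclic, where $\Gamma = \{\gamma_n : n \in \mathbb{N}_0\}$.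
   Context: $\mathbb{N}_0=\{0,1,2,\dots\}$, $\mathbb{C}^*=\mathbb{C}\setminus\{0\}$. All Banach spaces are complex, separable and infinite-dimensional; $\mathscr{L}(X)$ is the space of bounded linear operators on $X$. The map $S$ is not assumed linear or continuous; $S^0$ is the identity. A Furstenberg family is a family $\mathscr{F}$ of subsets of $\mathbb{N}_0$ with $\emptyset\notin\mathscr{F}\neq\emptyset$ that is hereditarily upward: if $E\subset F\subset\mathbb{N}_0$ and $E\in\mathscr{F}$, then $F\in\mathscr{F}$. A hypercyclicity set is a Furstenberg family $\mathscr{F}$ for which there exists a sequence $(A_k)_{k\geq1}$ of pairwise disjoint sets in $\mathscr{F}$ such that for any $j\in A_k$ and $j'\in A_{k'}$ with $j\neq j'$ we have $|j-j'|\geq\max\{k,k'\}$. For $\Gamma\subset\mathbb{C}$, $x\in X$ and $U\subset X$ put $\mathcal{N}_T(\Gamma x,U):=\{n\in\mathbb{N}_0: T^n(\Gamma x)\cap U\neq\emptyset\}$, where $\Gamma x=\{\lambda x:\lambda\in\Gamma\}$. $T$ is $\mathscr{F}_\Gamma$-hypercyclic if there is $x\in X$ such that $\mathcal{N}_T(\Gamma x,U)\in\mathscr{F}$ for every non-empty open set $U\subset X$. For $\Gamma\subset\mathbb{C}^*$, $\Gamma^{-1}:=\{a^{-1}:a\in\Gamma\}$. *)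

(* Defs.v *)
From HB Require Import structures.
From mathcomp Require Import all_boot all_order all_algebra.
From mathcomp Require Import all_classical all_reals all_analysis.
From mathcomp Require Export complex.

Set Implicit Arguments.
Unset Strict Implicit.
Unset Printing Implicit Defensive.

Import Order.TTheory GRing.Theory Num.Theory.
Import numFieldNormedType.Exports.

Local Open Scope classical_set_scope.
Local Open Scope ring_scope.

Definition separable_space (X : topologicalType) : Prop :=
  exists C : set X, countable C /\ dense C.

Definition infinite_dimensional (K : numFieldType) (X : lmodType K) : Prop :=
  ~ exists (n : nat) (e : 'I_n -> X),
      forall x : X, exists c : 'I_n -> K, x = \sum_(i < n) c i *: e i.

Section ComplexNorm.
Context {R : realType} {X : normedModType R[i]}.

(* On a normed module over R[i] the norm [`|x|] is a nonnegative element of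
   R[i], hence real; [rnorm x] is that number as an element of R. *)
Definition rnorm (x : X) : R := complex.Re `|x|.

Definition bounded_operator (T : X -> X) : Prop :=
  exists M : R, forall x : X, rnorm (T x) <= M * rnorm x.

End ComplexNorm.

Definition furstenberg_family (F : set (set nat)) : Prop :=
  [/\ ~ F set0, F !=set0 &
      forall A B : set nat, A `<=` B -> F A -> F B].

(* The sequence is indexed by k >= 1; the value [A 0%N] is irrelevant. *)
Definition hypercyclicity_set (F : set (set nat)) : Prop :=
  furstenberg_family F /\
  exists A : nat -> set nat,
    [/\ forall k, (1 <= k)%N -> F (A k),
        trivIset [set k | (1 <= k)%N] A &
        forall k k' j j' : nat, (1 <= k)%N -> (1 <= k')%N ->
          A k j -> A k' j' -> j <> j' ->
          (maxn k k' <= `|j%:Z - j'%:Z|)%N].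

Section Hypercyclicity.
Context {K : numFieldType} {X : normedModType K}.

Definition scaled_points (G : set K) (x : X) : set X := [set l *: x | l in G].

Definition return_set (T : X -> X) (A U : set X) : set nat :=
  [set n | (iter n T @` A) `&` U !=set0].

Definition hypercyclic (F : set (set nat)) (G : set K) (T : X -> X) : Prop :=
  exists x : X, forall U : set X, open U -> U !=set0 ->
    F (return_set T (scaled_points G x) U).

End Hypercyclicity.

(* Main.v *)
Require Import Defs.
From HB Require Import structures.
From mathcomp Require Import all_boot all_order all_algebra.
From mathcomp Require Import all_classical all_reals all_analysis.
From mathcomp Require Import zify.
Import Order.TTheory GRing.Theory Num.Theory.
Import numFieldNormedType.Exports.
Local Open Scope classical_set_scope.
Local Open Scope ring_scope.

(** Since the sets of the hypercyclicity family are more and more separated, a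
    vector can be prepared so that its orbit visits one target along each of
    them. Fix a sequence [y k] in [D] that comes close to every vector infinitely
    often, pick indices [s 0 < s 1 < ...], put [B k := A (s k)], and consider

      [x = \sum_k \sum_(n in B k) gamma n *: S^n (y k)].

    By (i), the inner sum is small as soon as [B k] starts late, and [B k] does
    start late when [s k] is large, because the sets [A k] are pairwise disjoint;
    so [x] exists. Since [T] undoes [S], for [r] in [B k] the term [n = r] of
    [gamma r^-1 *: T^r x] is exactly [y k], and the term of index [n] in [B l] is
    [(gamma n / gamma r) *: T^(r - n) (y l)] for [n < r] and
    [(gamma n / gamma r) *: S^(n - r) (y l)] for [n > r]. The separation property
    says that [|n - r| >= max (s k) (s l)] for these terms, so their norms add up,
    for each [l], to at most the quantity of (ii) for [y l] at [max (s k) (s l)]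
    ([separation_error_bound]). If [s k] is so large that the quantities of
    [y 0], ..., [y k] are below [4^-(k+1)] from [s k] on, then the contribution of
    [l] is at most [2^-(k+1) * 2^-(l+1)], whichever of [k] and [l] is larger, and
    summing over [l] gives [rnorm (gamma r^-1 *: T^r x - y k) <= 2^-(k+1)] for
    every [r] in [B k]. An open set thus contains [T^r (gamma r^-1 *: x)] for all
    [r] in some [B k], and [B k] belongs to the family.

    The rearrangements are all of nonnegative series in the extended reals:
    [superposition] builds [x] as a simple series over [n] and compares it with
    the double series over [k] and [n] in [B k] ([nneseries_le_double]). *)

(** * The real-valued norm *)

Section RealNorm.
Context {R : realType} {X : normedModType R[i]}.
Implicit Types (x y z : X) (e : R).

Lemma rnormE x : `|x| = (rnorm x)%:C%C.
Proof. by rewrite /rnorm RRe_real// ger0_real. Qed.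

Lemma rnorm_ge0 x : 0 <= rnorm x.
Proof. by rewrite -lecR -rnormE normr_ge0. Qed.

Lemma rnorm0 : rnorm (0 : X) = 0.
Proof. by rewrite /rnorm normr0. Qed.

Lemma ler_rnormD x y : rnorm (x + y) <= rnorm x + rnorm y.
Proof. by rewrite -lecR rmorphD /= -!rnormE ler_normD. Qed.

Lemma ler_rnorm_dist y x z : rnorm (x - z) <= rnorm (x - y) + rnorm (y - z).
Proof. by rewrite -[x - z](subrKA y) ler_rnormD. Qed.

Lemma rnormZ (c : R[i]) x : rnorm (c *: x) = complex.Re `|c| * rnorm x.
Proof.
have cE : `|c| = (complex.Re `|c|)%:C%C by rewrite RRe_real// ger0_real.
by apply: complexI; rewrite -rnormE normrZ rnormE {1}cE -rmorphM.
Qed.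

Lemma ler_rnorm_sum (I : Type) (s : seq I) (P : pred I) (u : I -> X) :
  rnorm (\sum_(i <- s | P i) u i) <= \sum_(i <- s | P i) rnorm (u i).
Proof.
elim/big_rec2: _ => [|i a x _ le_xa]; first by rewrite rnorm0.
by rewrite (le_trans (ler_rnormD _ _))// lerD2l.
Qed.

Lemma open_rnorm {U : set X} {x} : open U -> U x ->
  exists2 e, 0 < e & forall y, rnorm (y - x) < e -> U y.
Proof.
move=> oU Ux; have /nbhs_normP[/= d d0 dU] : \near x, U x by exact: open_nbhs_nbhs.
have dE : d = (complex.Re d)%:C%C by rewrite RRe_real// gtr0_real.
exists (complex.Re d) => [|y xy]; first by rewrite -ltcR -dE.
by apply: dU; rewrite /= dE distrC rnormE ltcR.
Qed.

Lemma dense_rnorm {D : set X} x {e} : dense D -> 0 < e ->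
  exists2 y, D y & rnorm (y - x) < e.
Proof.
move=> dD e0; have e0C : 0 < e%:C%C by rewrite ltcR.
have [||y [xy Dy]] := dD (ball x e%:C%C).
- by exists x; exact: ballxx.
- exact: ball_open.
by exists y => //; move: xy; rewrite -ball_normE/= distrC rnormE ltcR.
Qed.

End RealNorm.

(** * Absolutely convergent series *)

Lemma cvge0_near_lt {R : realType} {f : nat -> \bar R} {e : R} :
  f @ \oo --> 0%E -> 0 < e -> \forall n \near \oo, (f n < e%:E)%E.
Proof.
move=> f0 e0; apply: (f0 [set x | x < e%:E]%E).
by apply: open_nbhs_nbhs; split; [exact: open_ereal_lt_ereal | rewrite /= lte_fin].
Qed.

Lemma rnorm_summable_cvg {R : realType} {X : completeNormedModType R[i]}
    (u : nat -> X) :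
  (\sum_(0 <= n <oo) (rnorm (u n))%:E < +oo)%E ->
  exists x, forall e : R, 0 < e ->
    \forall n \near \oo, rnorm (x - \sum_(0 <= i < n) u i) < e.
Proof.
move=> u_fin.
have nn_u n : (0 <= (rnorm (u n))%:E)%E by rewrite lee_fin rnorm_ge0.
have tail0 := nneseries_tail_cvg u_fin (fun n _ => nn_u n).
have /cauchy_cvgP u_cvg : cauchy (series u @ \oo).
  apply/cauchy_seriesP => e e0.
  have eE : e = (complex.Re e)%:C%C by rewrite RRe_real// gtr0_real.
  have e0' : 0 < complex.Re e by rewrite -ltcR -eE.
  have [N _ tailN] := cvge0_near_lt tail0 e0'.
  exists ([set n | (N <= n)%N], [set: nat]) => /= [|[m n] /= [Nm _]].
    by split; [exists N | exact: filterT].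
  rewrite eE rnormE ltcR -lte_fin (le_lt_trans _ (tailN _ Nm))//.
  apply: le_trans (nneseries_lim_ge n (fun i _ _ => nn_u i)).
  by rewrite sumEFin lee_fin ler_rnorm_sum.
exists (limn (series u)) => e e0.
have e0C : 0 < e%:C%C by rewrite ltcR.
have /cvgr_distC_lt/(_ _ e0C) := u_cvg.
by apply: filterS => n; rewrite distrC rnormE ltcR.
Qed.

(** * Nonnegative series over sets of indices *)

Section Series.
Context {R : realType}.
Implicit Types (f g h : nat -> \bar R) (a : nat -> nat -> \bar R).

(** Unlike [lee_nneseries], the comparison is only required from the starting
    index on. *)
Lemma le_nneseries_from (N : nat) f g :
  (forall n, 0 <= f n)%E -> (forall n, (N <= n)%N -> f n <= g n)%E ->
  (\sum_(N <= n <oo) f n <= \sum_(N <= n <oo) g n)%E.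
Proof.
move=> f0 fg; rewrite eseries_cond [leRHS]eseries_cond.
by apply: lee_nneseries => n //; exact: fg.
Qed.

Lemma nneseries_in_mkcond (A : set nat) f :
  (\sum_(0 <= n <oo | n \in A) f n = \sum_(0 <= n <oo) if n \in A then f n else 0)%E.
Proof. exact: (@eseries_mkcond _ (fun n => n \in A)). Qed.

(** This turns a series over [n], each of whose terms comes from one of the sets
    [B k], into a series over [k]: after exchanging the two sums on the right,
    each [f n] is one of the nonnegative terms of the inner sum. *)
Lemma nneseries_le_double (B : nat -> set nat) f a :
  (forall n, 0 <= f n)%E -> (forall k n, 0 <= a k n)%E ->
  (forall n, f n = 0%E \/ exists2 k, B k n & (f n <= a k n)%E) ->
  (\sum_(0 <= n <oo) f n <=
   \sum_(0 <= k <oo) \sum_(0 <= n <oo | n \in B k) a k n)%E.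
Proof.
move=> f0 a0 fa; pose b k n := (if n \in B k then a k n else 0)%E.
have b0 k n : (0 <= b k n)%E by rewrite /b; case: ifP.
under [leRHS]eq_eseriesr do rewrite nneseries_in_mkcond.
rewrite (nneseries_interchange (a := b))//.
apply: le_nneseries_from => // n _.
have [->|[k Bkn /le_trans->//]] := fa n; first exact: nneseries_ge0.
apply: le_trans (nneseries_lim_ge k.+1 _) => //.
by rewrite big_nat_recr//= {2}/b mem_set// leeDr// sume_ge0.
Qed.

Lemma nneseries_tail_le (A : set nat) f (N : nat) :
  (forall n, 0 <= f n)%E -> (forall n, A n -> (N <= n)%N) ->
  (\sum_(0 <= n <oo | n \in A) f n <= \sum_(N <= n <oo) f n)%E.
Proof.
move=> f0 AN; rewrite nneseries_in_mkcond (nneseries_split 0 N) => [|n _]; last first.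
  by case: ifP.
rewrite add0n big_nat_cond big1 ?add0e => [|n /andP[nN _]].
  by apply: le_nneseries_from => n; case: ifP.
by case: ifP => // /set_mem/AN; lia.
Qed.

(** If [A] avoids the open interval of radius [M] around [r], a series over [A]
    splits into the indices before and after the gap. When [r < M] nothing lies
    before the gap, although the truncated [(r - M).+1] would still count one
    term; hence the case distinction. *)
Lemma nneseries_gap_le (A : set nat) f g h (r M : nat) : (0 < M)%N ->
  (forall n, 0 <= f n)%E -> (forall n, 0 <= g n)%E ->
  (forall n, A n -> (n + M <= r)%N \/ (M + r <= n)%N) ->
  (forall n, (n + M <= r)%N -> f n <= g n)%E ->
  (forall n, (M + r <= n)%N -> f n <= h n)%E ->
  (\sum_(0 <= n <oo | n \in A) f n <=
   (if (M <= r)%N then \sum_(0 <= n < (r - M).+1) g n else 0) +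
   \sum_(M + r <= n <oo) h n)%E.
Proof.
move=> M0 f0 g0 gapA fg fh; rewrite nneseries_in_mkcond.
have b0 n : (0 <= if n \in A then f n else 0)%E by case: ifP.
have bgap n : (r < n + M)%N -> (n < M + r)%N -> (if n \in A then f n else 0)%E = 0%E.
  by move=> ? ?; case: ifP => // /set_mem/gapA; lia.
rewrite (nneseries_split 0 (M + r))// add0n; apply: leeD; last first.
  by apply: le_nneseries_from => // n Mn; case: ifP => _; rewrite (le_trans _ (fh _ Mn)).
case: leqP => [Mr | rM].
  rewrite (big_cat_nat _ (n := (r - M).+1)) //=; last by lia.
  rewrite [X in (_ + X)%E]big_nat_cond [X in (_ + X)%E]big1 ?adde0.
    rewrite big_nat_cond [leRHS]big_nat_cond; apply: lee_sum => n.
    by move=> /andP[? _]; case: ifP => // _; apply: fg; lia.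
  by move=> n /andP[? _]; apply: bgap; lia.
rewrite big_nat_cond big1// => n /andP[? _].
by apply: bgap; lia.
Qed.

End Series.

(** * Selection of indices and of targets *)

(** Each [j < N] lies in at most one of the disjoint sets, so all but finitely
    many of them avoid the whole initial segment. *)
Lemma trivIset_near_ge (A : nat -> set nat) (N : nat) :
  trivIset [set k | (1 <= k)%N] A ->
  \forall m \near \oo, forall j, A m j -> (N <= j)%N.
Proof.
move=> tA.
suff: \forall m \near \oo, forall i : 'I_N, ~ A m i.
  apply: filterS => m Am j Amj; rewrite leqNgt; apply/negP => jN.
  exact: Am (Ordinal jN) Amj.
apply: filter_forall => i.
have [[m [m0 Ami]]|noA] := pselect (exists m, (1 <= m)%N /\ A m i).
  exists m.+1 => // n /= mn Ani.
  have /tA : (1 <= n)%N by lia.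
  by move=> /(_ m m0) mnE; have := mnE (ex_intro _ _ (conj Ani Ami)); lia.
by exists 1%N => // n n0 Ani; apply: noA; exists n.
Qed.

Lemma near_subsequence (P : nat -> nat -> Prop) :
  (forall k, \forall m \near \oo, P k m) ->
  exists s : nat -> nat, {homo s : i j / (i < j)%N} /\ forall k, P k (s k).
Proof.
move=> nearP.
have /choice[g gP] k : exists g, forall m, (g <= m)%N -> P k m.
  by have [g _ gP] := nearP k; exists g.
(* Adding up the thresholds makes the sequence increasing without losing them. *)
exists (fun k => \sum_(0 <= i < k.+1) (g i).+1)%N; split => [|k].
  by apply: homo_ltn => [|k]; [exact: ltn_trans | rewrite [ltnRHS]big_nat_recr//=; lia].
by apply: gP; rewrite big_nat_recr//=; lia.
Qed.

(** Targets for the construction: a sequence in [D] that approximates every vector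
    at arbitrarily late indices. The vector [y k] is chosen within [1 / (k + 1)] of
    the point number [logn 2 (k + 1)] of a countable dense set, because the 2-adic
    valuation takes every value infinitely often. *)
Lemma frequent_dense_sequence {R : realType} {X : normedModType R[i]} {D : set X} :
  separable_space X -> dense D ->
  exists2 y : nat -> X, forall k, D (y k) &
    forall (x : X) (e : R) (K : nat), 0 < e ->
      exists2 k, (K <= k)%N & rnorm (y k - x) < e.
Proof.
move=> [C [/countable_injP[f finj] dC]] dD.
pose c i := xget 0 [set z | C z /\ f z = i].
have cf z : C z -> c (f z) = z.
  move=> Cz; rewrite /c; case: xgetP => [w _ [Cw fwz]|/(_ z)[]//].
  by apply: finj => //; rewrite inE.
have /choice[y yP] k : exists y, D y /\ rnorm (y - c (logn 2 k.+1)) < k.+1%:R^-1.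
  have [|y] := dense_rnorm (c (logn 2 k.+1)) dD (e := k.+1%:R^-1).
    by rewrite invr_gt0.
  by exists y.
exists y => [k|x e K e0]; first by have [] := yP k.
have e20 : 0 < e / 2 by rewrite divr_gt0.
have [z Cz zx] := dense_rnorm x dC e20.
have [N _ NP] := near_infty_natSinv_lt (PosNum e20).
(* The odd factor makes the index large and leaves the valuation at [f z]. *)
pose q := (2 ^ f z * 3 ^ maxn K N)%N.
have q_gt : (maxn K N < q)%N.
  by rewrite (leq_trans (ltn_expl _ (isT : (1 < 3)%N)))// leq_pmull// expn_gt0.
have qS : q.-1.+1 = q by rewrite prednK//; lia.
exists q.-1; first by lia.
have qlog : logn 2 q.-1.+1 = f z.
  by rewrite qS /q mulnC logn_Gauss ?pfactorK// coprimeXr.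
have [_] := yP q.-1; rewrite qlog cf// => yz.
rewrite (le_lt_trans (ler_rnorm_dist z _ _))// (splitr e) ltrD//.
by apply: lt_trans yz _; apply: (NP q.-1); rewrite /=; lia.
Qed.

(** * Powers of the operator and their right inverses *)

Section Operator.
Context {R : realType} {X : normedModType R[i]}.

Lemma bounded_operator_ge0 (T : X -> X) : bounded_operator T ->
  exists2 M : R, 0 <= M & forall x, rnorm (T x) <= M * rnorm x.
Proof.
move=> [M TM]; exists `|M| => // x; apply: le_trans (TM x) _.
by rewrite ler_wpM2r ?rnorm_ge0 ?ler_norm.
Qed.

Lemma bounded_iter (T : {linear X -> X}) (r : nat) : bounded_operator T ->
  exists2 L : {linear X -> X}, L =1 iter r T & bounded_operator L.
Proof.
move=> /bounded_operator_ge0[M M0 TM]; elim: r => [|r [L LE [N LN]]].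
  by exists idfun => //; exists 1 => x; rewrite mul1r.
exists (T \o L) => [x|]; first by rewrite /= LE.
exists (M * N) => x; rewrite (le_trans (TM _))// -mulrA.
by rewrite ler_wpM2l.
Qed.

Lemma bounded_scale (L : X -> X) (c : R[i]) :
  bounded_operator L -> bounded_operator (fun x => c *: L x).
Proof.
move=> [M LM]; exists (complex.Re `|c| * M) => x; rewrite rnormZ -mulrA.
by rewrite ler_wpM2l//; have := normr_ge0 c; rewrite lecE => /andP[].
Qed.

(** Boundedness of [L] lets it act on the series termwise: up to the image of a
    remainder of the series, [L x - L (u r)] is a finite sum of the other terms
    [L (u n)]. *)
Lemma rnorm_sub_term_le (L : {linear X -> X}) (u : nat -> X) (x : X) (r : nat) (e : R) :
  bounded_operator L ->
  (forall d : R, 0 < d -> \forall n \near \oo, rnorm (x - \sum_(0 <= i < n) u i) < d) ->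
  (\sum_(0 <= n <oo) (if n == r then 0 else (rnorm (L (u n)))%:E) <= e%:E)%E ->
  rnorm (L x - L (u r)) <= e.
Proof.
move=> /bounded_operator_ge0[M M0 LM] ux le_e; apply/ler_addgt0Pr => d d0.
have dM0 : 0 < d / (M + 1) by rewrite divr_gt0// ltr_wpDl.
have [N _ NP] := ux _ dM0.
pose n := maxn N r.+1; pose s := \sum_(0 <= i < n) u i.
have /NP xs : (N <= n)%N by rewrite leq_maxl.
rewrite (le_trans (ler_rnorm_dist (L s) _ _))// addrC lerD//.
  have -> : L s - L (u r) = \sum_(0 <= i < n | i != r) L (u i).
    rewrite /s linear_sum (bigD1_seq r)/= ?iota_uniq// ?mem_index_iota ?leq_maxr//.
    by rewrite addrC addrK.
  rewrite (le_trans (ler_rnorm_sum _ _ _ _))// -lee_fin (le_trans _ le_e)//.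
  apply: le_trans (nneseries_lim_ge n _); last first.
    by move=> i _ _; case: eqP => // _; rewrite lee_fin rnorm_ge0.
  by rewrite -sumEFin big_mkcond/=; apply: lee_sum => i _; case: eqP.
rewrite -linearB (le_trans (LM _))//.
rewrite (le_trans (ler_wpM2l M0 (ltW xs)))// mulrCA ler_piMr ?ltW//.
by rewrite ltr_pdivrMr ?mul1r ?ltrDl// ltr_wpDl.
Qed.

Lemma iter_right_inverse (D : set X) (S T : X -> X) (y : X) (r n : nat) :
  (forall z, D z -> D (S z)) -> (forall z, D z -> T (S z) = z) -> D y ->
  iter r T (iter n S y) =
  if (n <= r)%N then iter (r - n) T y else iter (n - r) S y.
Proof.
move=> DS TS Dy.
have Diter m : D (iter m S y) by elim: m => //= m; exact: DS.
elim: r n => [|r IH] [|n]; rewrite ?leqn0 ?sub0n ?subn0//.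
by rewrite iterSr [iter n.+1 S y]/= TS// IH ltnS subSS.
Qed.

(** The quantity of hypothesis (ii) for the vector [y]. *)
Definition separation_error (T S : X -> X) (gamma : nat -> R[i]) (y : X)
    (M : nat) : \bar R :=
  (ereal_sup
     [set \sum_(0 <= n < (r - M).+1)
            (rnorm ((gamma n / gamma r) *: iter (r - n) T y))%:E
       | r in [set r : nat | (M <= r)%N]]
   + ereal_sup
     [set \sum_(M + r <= n <oo)
            (rnorm ((gamma n / gamma r) *: iter (n - r) S y))%:E
       | r in [set r : nat | (1 <= r)%N]])%E.

(** The terms before the gap around [r] carry powers of [T] and are controlled by
    the first supremum, those after it carry powers of [S] and are controlled by
    the second one. *)
Lemma separation_error_bound (D : set X) (T S : X -> X) (gamma : nat -> R[i])
    (y : X) (A : set nat) (r M : nat) :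
  (forall z, D z -> D (S z)) -> (forall z, D z -> T (S z) = z) -> D y ->
  (0 < M)%N -> (0 < r)%N ->
  (forall n, A n -> (n + M <= r)%N \/ (M + r <= n)%N) ->
  (\sum_(0 <= n <oo | n \in A)
     (rnorm ((gamma n / gamma r) *: iter r T (iter n S y)))%:E
   <= separation_error T S gamma y M)%E.
Proof.
move=> DS TS Dy M0 r0 gapA.
have nn_rnorm (x : X) : (0 <= (rnorm x)%:E)%E by rewrite lee_fin rnorm_ge0.
have TSE n := iter_right_inverse D S T y r n DS TS Dy.
apply: le_trans (nneseries_gap_le _ _
  (fun n => (rnorm ((gamma n / gamma r) *: iter (r - n) T y))%:E)
  (fun n => (rnorm ((gamma n / gamma r) *: iter (n - r) S y))%:E)
  r M _ _ _ gapA _ _) _ => //.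
- by move=> n nM; rewrite TSE ifT//; lia.
- by move=> n Mn; rewrite TSE ifF//; lia.
- apply: leeD; last by apply: ereal_sup_ubound; exists r.
  case: leqP => Mr; first by apply: ereal_sup_ubound; exists r.
  (* Nothing lies before the gap, and the supremum is nonnegative. *)
  apply: le_trans (ereal_sup_ubound _); last by exists M => /=.
  exact: sume_ge0.
Qed.

End Operator.

(** * The vector and its orbit *)

(** The same [x] has to serve all the operators [gamma r^-1 *: T^r], so it is
    built before [L] is given. By disjointness each [n] carries at most one term
    [w k n], which makes the double series a simple one over [n]; there the term
    of index [r] can be singled out. *)
Lemma superposition {R : realType} {X : completeNormedModType R[i]}
    (B : nat -> set nat) (w : nat -> nat -> X) :
  trivIset setT B ->
  (\sum_(0 <= k <oo) \sum_(0 <= n <oo | n \in B k) (rnorm (w k n))%:E < +oo)%E ->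
  exists x : X, forall (L : {linear X -> X}) (k r : nat) (e : R),
    bounded_operator L -> B k r ->
    (\sum_(0 <= l <oo) \sum_(0 <= n <oo | n \in B l `\ r) (rnorm (L (w l n)))%:E
      <= e%:E)%E ->
    rnorm (L x - L (w k r)) <= e.
Proof.
move=> tB w_fin.
have nn_rnorm (x : X) : (0 <= (rnorm x)%:E)%E by rewrite lee_fin rnorm_ge0.
pose u n : X := if pselect (exists k, B k n) is left ex
  then w (projT1 (cid ex)) n else 0.
have uE k n : B k n -> u n = w k n.
  move=> Bkn; rewrite /u; case: pselect => [ex|[]]; last by exists k.
  by case: (cid ex) => l Bln /=; rewrite (tB k l)//; exists n.
have u0 n : u n = 0 \/ exists k, B k n.
  by rewrite /u; case: pselect => [ex|]; [right | left].
have [x xu] : exists x, forall d : R, 0 < d ->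
    \forall n \near \oo, rnorm (x - \sum_(0 <= i < n) u i) < d.
  apply: rnorm_summable_cvg; apply: le_lt_trans w_fin.
  apply: nneseries_le_double => // n.
  have [->|[k Bkn]] := u0 n; [by left; rewrite rnorm0 | right].
  by exists k => //; rewrite (uE k).
exists x => L k r e bL Bkr le_e; rewrite -(uE k)//.
apply: rnorm_sub_term_le => //; apply: le_trans le_e.
apply: nneseries_le_double => // n; first by case: ifP.
case: eqP => [_|nr]; first by left.
have [->|[l Bln]] := u0 n; [by left; rewrite linear0 rnorm0 | right].
by exists l => //; rewrite (uE l).
Qed.

Theorem corollary3p5 (R : realType) (X : completeNormedModType R[i])
  (hsep : separable_space X) (hdim : infinite_dimensional X)
  (T : {linear X -> X}) (hT : bounded_operator T)
  (gamma : nat -> R[i]) (hgamma : forall n : nat, gamma n != 0)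
  (F : set (set nat)) (hF : hypercyclicity_set F) :
  (exists (D : set X) (S : {fun D >-> D}),
    dense D /\
    forall y : X, D y ->
      [/\ (\sum_(0 <= n <oo) (rnorm (gamma n *: iter n S y))%:E < +oo)%E,
          (ereal_sup
             [set \sum_(0 <= n < (r - m).+1)
                    (rnorm ((gamma n / gamma r) *: iter (r - n) T y))%:E
               | r in [set r : nat | (m <= r)%N]]
           + ereal_sup
             [set \sum_(m + r <= n <oo)
                    (rnorm ((gamma n / gamma r) *: iter (n - r) S y))%:E
               | r in [set r : nat | (1 <= r)%N]])%E @[m --> \oo] --> 0%E
        & T (S y) = y]) ->
  hypercyclic F [set a^-1 | a in range gamma] T.
Proof.
case: hF => -[_ _ Fup] [A [FA tA gapA]] [D [S [dD DS]]].
have DSD z : D z -> D (S z) by exact: funS.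
have TSK z : D z -> T (S z) = z by move=> /DS[].
have [y Dy y_dense] := frequent_dense_sequence hsep dD.
(* The form in which [epsilon_trick0] sums a geometric series. *)
pose e k : R := 1 / (2 ^ k.+1)%:R.
have e0 k : 0 < e k by rewrite divr_gt0// ltr0n expn_gt0.
have e_le k l : (k <= l)%N -> e l <= e k.
  by move=> kl; rewrite /e !div1r lef_pV2 ?posrE ?ltr0n ?expn_gt0// ler_nat leq_exp2l.
pose phi l := separation_error T S gamma (y l).
pose tail k N := (\sum_(N <= n <oo) (rnorm (gamma n *: iter n S (y k)))%:E)%E.
(* The members of [A m] have to be positive because the second supremum of (ii)
   only concerns [r >= 1]. *)
pose P k m := [/\ (1 <= m)%N, forall j, A m j -> (1 <= j)%N,
  forall l, (l <= k)%N -> forall m', (m <= m')%N ->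
    (phi l m' < (e k * e k)%:E)%E &
  exists2 N, forall j, A m j -> (N <= j)%N & (tail k N < (e k)%:E)%E].
have nn_rnorm (x : X) : (0 <= (rnorm x)%:E)%E by rewrite lee_fin rnorm_ge0.
have [s [s_inc sP]] : exists s : nat -> nat,
    {homo s : i j / (i < j)%N} /\ forall k, P k (s k).
  apply: near_subsequence => k.
  have near_phi : \forall m \near \oo, forall l : 'I_k.+1, forall m',
      (m <= m')%N -> (phi l m' < (e k * e k)%:E)%E.
    apply: filter_forall => l.
    have [_ phi0 _] := DS _ (Dy l).
    have [N _ NP] := cvge0_near_lt phi0 (mulr_gt0 (e0 k) (e0 k)).
    by exists N => // m /= Nm m' mm'; apply: NP; exact: leq_trans mm'.
  have [fin_k _ _] := DS _ (Dy k).
  have [N _ NP] := cvge0_near_lt (nneseries_tail_cvg fin_k (fun _ _ => nn_rnorm _)) (e0 k).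
  have A1 := trivIset_near_ge A 1 tA.
  have AN := trivIset_near_ge A N tA.
  near=> m; split.
  - by near: m; exists 1%N.
  - by near: m.
  - suff phi_m : forall (l : 'I_k.+1) m', (m <= m')%N ->
        (phi l m' < (e k * e k)%:E)%E.
      by move=> l lk; exact: (phi_m (Ordinal (lk : (l < k.+1)%N))).
    by near: m.
  - by exists N; [near: m | exact: NP (leqnn N)].
pose B k := A (s k).
have sS k : (1 <= s k)%N by have [] := sP k.
have tB : trivIset setT B.
  move=> k l _ _ /(tA _ _ (sS k) (sS l)) skl.
  by case: (ltngtP k l) => // /s_inc; rewrite skl ltnn.
have smax k l : maxn (s k) (s l) = s (maxn k l).
  by case: (ltngtP k l) => [/s_inc|/s_inc|->]; rewrite ?maxnn//; lia.
have [|x xP] := superposition B (fun k n => gamma n *: iter n S (y k)) tB.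
  apply: (@le_lt_trans _ _ 1%:E); last exact: ltry.
  apply: le_trans (epsilon_trick0 xpredT ler01).
  apply: le_nneseries_from => k; first exact: nneseries_ge0.
  move=> _; have [_ _ _ [N BN /ltW]] := sP k; apply: le_trans.
  exact: nneseries_tail_le.
have approx k r : B k r -> rnorm ((gamma r)^-1 *: iter r T x - y k) <= e k.
  move=> Bkr.
  have [L0 L0E bL0] := bounded_iter T r hT.
  pose L : {linear X -> X} := (gamma r)^-1 \*: L0.
  have LE z : L z = (gamma r)^-1 *: iter r T z by rewrite /L /= L0E.
  have LwE l n : L (gamma n *: iter n S (y l)) =
      (gamma n / gamma r) *: iter r T (iter n S (y l)).
    by rewrite linearZ_LR LE scalerA.
  have yE : L (gamma r *: iter r S (y k)) = y k.
    by rewrite LwE (iter_right_inverse D)// leqnn subnn divff// scale1r.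
  rewrite -LE -{1}yE; apply: xP => //; first exact: bounded_scale.
  apply: le_trans (epsilon_trick0 xpredT (ltW (e0 k))).
  apply: le_nneseries_from => l; first exact: nneseries_ge0.
  move=> _; pose q := maxn k l; pose M := s q.
  apply: (@le_trans _ _ (phi l M)).
    under eq_eseriesr do rewrite LwE.
    have [_ /(_ r Bkr) r0 _ _] := sP k.
    apply: (separation_error_bound D) => //; first exact: sS.
    move=> n [Bln nr]; have /= := gapA _ _ _ _ (sS k) (sS l) Bkr Bln.
    rewrite smax -/q -/M => /(_ (fun rn => nr (esym rn))); lia.
  have sqM : (s q <= M)%N by [].
  have [_ _ /(_ l (leq_maxr k l) M sqM)/ltW phi_le _] := sP q.
  apply: le_trans phi_le _; rewrite lee_fin.
  (* The bound at the larger index is split between [k] and [l]. *)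
  have -> : e k / (2 ^ l.+1)%:R = e k * e l by congr (_ * _); rewrite /e div1r.
  by apply: ler_pM (ltW (e0 _)) (ltW (e0 _)) (e_le _ _ (leq_maxl k l)) (e_le _ _ (leq_maxr k l)).
exists x => U oU [z Uz].
have [d d0 dU] := open_rnorm oU Uz.
have d20 : 0 < d / 2 by rewrite divr_gt0.
have [N _ NP] := near_infty_natSinv_lt (PosNum d20).
have [k Nk yz] := y_dense z (d / 2) N d20.
apply: (Fup (B k)); last exact: FA.
move=> r Bkr; exists ((gamma r)^-1 *: iter r T x); split.
  exists ((gamma r)^-1 *: x).
    by exists (gamma r)^-1 => //; exists (gamma r) => //; exists r.
  by have [L LE _] := bounded_iter T r hT; rewrite -!LE linearZ.
apply: dU; apply: le_lt_trans (ler_rnorm_dist (y k) _ _) _.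
rewrite (splitr d) ltrD//; apply: le_lt_trans (approx _ _ Bkr) _.
apply: le_lt_trans (NP k Nk).
rewrite /e div1r lef_pV2 ?posrE ?ltr0n ?expn_gt0// ler_nat.
by rewrite ltnW// ltn_expl.
Unshelve. all: by end_near. Qed.
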